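(* Let $Q$ be a network without leaf arcs, let $g$ be its girth, and let $0<\alpha\le g$. Let $S_2$ be any closed unit speed path in $Q$ that traverses every arc exactly twice and never traverses an arc twice in succession in opposite directions. Then in the continuous patrolling game on $Q$ with attack duration $\alpha$: (1) the value is $V=\alpha/\mu$; (2) every uniform attack strategy is optimal for the Attacker; (3) the randomized periodic extension $\tilde S_2$ of $S_2$ is optimal for the Patroller.
   Context: A network $Q$ is a finite connected graph, possibly with multiple arcs and loops and with no node of degree two, and it is not a single line segment. Each arc $a$ is identified with an open interval of positive length $\lambda(a)$. The length measure $\lambda$ on $Q$ is Lebesgue measure on the arcs, $\mu=\lambda(Q)$, and $d(x,y)$ is the minimum length of a path from $x$ to $y$. A leaf node is a node of degree $1$ and its incident arc is a leaf arc. The continuous patrolling game with attack duration $\alpha>0$ is played as follows. The Patroller picks a patrol $S:[0,\infty)\to Q$ with $d(S(t),S(t'))\le|t-t'|$ for all $t,t'$ (a unit speed path). The Attacker picks a point $x\in Q$ and a start time $\tau\ge0$. The payoff to the Patroller is $1$ if $x\in S([\tau,\tau+\alpha])$ (the attack is intercepted) and $0$ otherwise. Mixed strategies are allowed, and the game has a value $V$, the optimal interception probability. Throughout, $0<\alpha<\bar\mu$, where $\bar\mu$ is the minimum length of a closed path visiting every point of $Q$. A circuit is a closed path consisting of distinct adjacent arcs. The girth $g$ of $Q$ is the minimum length of a circuit, with $g=\infty$ if there is none. A uniform attack strategy fixes $M\ge0$, attacks during $[M,M+\alpha]$, and chooses the attacked point with distribution $\lambda/\mu$. For a closed unit speed path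 $S:[0,L]\to Q$ and $\Delta\in[0,L]$, let $S_\Delta(t)=S((t+\Delta)\bmod L)$. The randomized periodic extension $\tilde S$ is the mixed patrol that uses $S_\Delta$ with $\Delta$ uniform on $[0,L]$. *)

(* Defs.v *)
From HB Require Import structures.
From mathcomp Require Import all_boot all_order all_algebra.
From mathcomp Require Import all_classical all_reals all_analysis.
From mathcomp Require Import lra.

Set Implicit Arguments.
Unset Strict Implicit.
Unset Printing Implicit Defensive.

Import Order.TTheory GRing.Theory Num.Theory.
Import numFieldNormedType.Exports.

Local Open Scope classical_set_scope.
Local Open Scope ring_scope.

(* The orientation given by [src] and [tgt] only serves to fix a coordinate
   on each arc; paths may traverse arcs in both directions. *)
Record metric_graph (R : realType) := MetricGraph {
  nodes : finType;
  arcs : finType;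
  src : arcs -> nodes;
  tgt : arcs -> nodes;
  len : arcs -> R;
  len_gt0 : forall a, 0 < len a }.

Section MetricGraph.
Context {R : realType}.
Variable G : metric_graph R.

(* [(a, true)] is the arc [a] traversed from [src a] to [tgt a], and
   [(a, false)] the same arc traversed from [tgt a] to [src a]. *)
Definition dart : finType := (arcs G * bool)%type.
Definition dart_src (e : dart) : nodes G := if e.2 then src e.1 else tgt e.1.
Definition dart_tgt (e : dart) : nodes G := if e.2 then tgt e.1 else src e.1.
Definition dart_rev (e : dart) : dart := (e.1, ~~ e.2).

(* A loop contributes both of its darts, hence counts twice. *)
Definition degree (v : nodes G) : nat := #|[set e : dart | dart_src e == v]|%SET.

Definition adjacent : rel (nodes G) :=
  [rel u v | [exists e : dart, (dart_src e == u) && (dart_tgt e == v)]].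

Definition line_segment : Prop :=
  exists a : arcs G, (forall b, b = a) /\ src a <> tgt a.

Definition leaf_arc (a : arcs G) : bool :=
  (degree (src a) == 1%N) || (degree (tgt a) == 1%N).

End MetricGraph.

Record network (R : realType) := Network {
  network_graph :> metric_graph R;
  node_nonempty : (0 < #|nodes network_graph|)%N;
  network_connected : forall u v, connect (@adjacent R network_graph) u v;
  no_degree_two : forall v : nodes network_graph, degree v <> 2%N;
  not_line_segment : ~ line_segment network_graph }.

(* The arc [a] is identified with the interval ]0, len a[. *)
Inductive npoint {R : realType} (Q : network R) : Type :=
| at_node of nodes Q
| on_arc (a : arcs Q) (s : R) of 0 < s < len a.
Arguments at_node {R Q}.

HB.instance Definition _ (R : realType) (Q : network R) :=
  gen_eqMixin (npoint Q).
HB.instance Definition _ (R : realType) (Q : network R) :=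
  gen_choiceMixin (npoint Q).

Section Points.
Context {R : realType}.
Variable Q : network R.

Definition base_node : nodes Q := enum_val (Ordinal (node_nonempty Q)).

(* The point at coordinate [s] of the closed arc [a]; coordinates outside of
   [0, len a] are clamped to the nearest end. *)
Definition arc_pt (a : arcs Q) (s : R) : npoint Q :=
  match @idP (0 < s < len a) with
  | ReflectT h => on_arc h
  | ReflectF _ => at_node (if s <= 0 then src a else tgt a)
  end.

(* [path_length x y l]: some path from [x] to [y], made of finitely many
   segments each contained in a closed arc, has length [l]. *)
Inductive path_length : npoint Q -> npoint Q -> R -> Prop :=
| path_nil x : path_length x x 0
| path_cons a s t y l : 0 <= s <= len a -> 0 <= t <= len a ->
    path_length (arc_pt a t) y l ->
    path_length (arc_pt a s) y (`|s - t| + l).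

(* Extended-real valued: [+oo] if no path joins [x] to [y], which connectedness
   excludes. *)
Definition dist (x y : npoint Q) : \bar R :=
  ereal_inf [set l%:E | l in path_length x y].

Lemma path_length_cat x y z l m :
  path_length x y l -> path_length y z m -> path_length x z (l + m).
Proof.
elim=> [u|a s t u k hs ht _ IH] yz; first by rewrite add0r.
by rewrite -addrA; apply: path_cons => //; exact: IH.
Qed.

Lemma path_length_sym x y l : path_length x y l -> path_length y x l.
Proof.
elim=> [u|a s t u k hs ht _ IH]; first exact: path_nil.
rewrite addrC; apply: path_length_cat IH _.
rewrite distrC -[X in path_length _ _ X]addr0.
by apply: path_cons => //; exact: path_nil.
Qed.

Lemma dist_sym x y : dist x y = dist y x.
Proof.
by congr ereal_inf; apply/seteqP; split=> _ [l h <-];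
  exists l => //; exact: path_length_sym.
Qed.

Lemma dist_refl x : (dist x x <= 0)%E.
Proof. by apply: ereal_inf_lbound; exists 0 => //; exact: path_nil. Qed.

Lemma dist_triangle x y z r s :
  (dist x y <= r%:E)%E -> (dist y z <= s%:E)%E -> (dist x z <= (r + s)%:E)%E.
Proof.
move=> hr hs; apply/lee_addgt0Pr => e e0.
have e20 : 0 < e / 2 by rewrite divr_gt0.
have [_ [l xy <-] hl] : exists2 u, [set l%:E | l in path_length x y] u &
    (u < (r + e / 2)%:E)%E.
  apply/ereal_inf_lt; apply: le_lt_trans hr _.
  by rewrite lte_fin ltrDl.
have [_ [m yz <-] hm] : exists2 u, [set l%:E | l in path_length y z] u &
    (u < (s + e / 2)%:E)%E.
  apply/ereal_inf_lt; apply: le_lt_trans hs _.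
  by rewrite lte_fin ltrDl.
apply: (@le_trans _ _ (l + m)%:E).
  by apply: ereal_inf_lbound; exists (l + m) => //; exact: path_length_cat xy yz.
rewrite -EFinD lee_fin; move: hl hm; rewrite !lte_fin => hl hm.
by rewrite (splitr e) addrACA lerD// ltW.
Qed.

Definition clamp (a : arcs Q) (s : R) : R :=
  if s <= 0 then 0 else if s < len a then s else len a.

Lemma clamp_itv a s : 0 <= clamp a s <= len a.
Proof.
have l0 := len_gt0 a; rewrite /clamp.
by case: ifPn => ?; [lra|case: ifPn => ?; lra].
Qed.

Lemma arc_pt_in a s (h : 0 < s < len a) : arc_pt a s = on_arc h.
Proof.
rewrite /arc_pt; case: {-}_ / idP => [h'|//].
by rewrite (bool_irrelevance h h').
Qed.

Lemma arc_pt_src a s : s <= 0 -> arc_pt a s = at_node (src a).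
Proof.
move=> s0; rewrite /arc_pt; case: {-}_ / idP => [h|_]; last by rewrite s0.
by exfalso; have /andP[] := h; rewrite (ltNge 0) s0.
Qed.

Lemma arc_pt_tgt a s : len a <= s -> arc_pt a s = at_node (tgt a).
Proof.
move=> ls; rewrite /arc_pt; case: {-}_ / idP => [h|_].
  by exfalso; have /andP[_] := h; rewrite ltNge ls.
by rewrite leNgt (lt_le_trans (len_gt0 a) ls).
Qed.

Lemma arc_pt_clamp a s : arc_pt a (clamp a s) = arc_pt a s.
Proof.
rewrite /clamp; case: ifPn => [s0|_]; first by rewrite !arc_pt_src.
by case: ltP => // ls; rewrite !arc_pt_tgt.
Qed.

Lemma clamp_lip a s t : `|clamp a s - clamp a t| <= `|s - t|.
Proof.
have l0 := len_gt0 a.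
have h1 : s - t <= `|s - t| by exact: ler_norm.
have h2 : t - s <= `|s - t| by rewrite distrC ler_norm.
rewrite ler_norml /clamp.
by do 2 (case: ifPn => ?; [|case: ifPn => ?]); apply/andP; split; lra.
Qed.

Lemma dist_arc_pt a s t : (dist (arc_pt a s) (arc_pt a t) <= `|s - t|%:E)%E.
Proof.
rewrite -(arc_pt_clamp a s) -(arc_pt_clamp a t).
apply: (@le_trans _ _ (`|clamp a s - clamp a t| + 0)%:E); last first.
  by rewrite addr0 lee_fin clamp_lip.
apply: ereal_inf_lbound; exists (`|clamp a s - clamp a t| + 0) => //.
by apply: path_cons; rewrite ?clamp_itv//; exact: path_nil.
Qed.

Definition nopen : set (set (npoint Q)) :=
  [set U | forall x, U x ->
     exists2 e : R, 0 < e & forall y, (dist x y < e%:E)%E -> U y].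

End Points.

HB.instance Definition _ (R : realType) (Q : network R) :=
  isPointed.Build (npoint Q) (at_node (base_node Q)).

Notation borel_network Q := (g_sigma_algebraType (@nopen _ Q)).

Section Lipschitz.
Context {R : realType}.
Variable Q : network R.

Lemma lipschitz_measurable (f : R -> borel_network Q) :
  (forall s t, (dist (f s) (f t) <= `|s - t|%:E)%E) ->
  measurable_fun [set: R] f.
Proof.
move=> lf; apply: (@measurability _ _ _ _ _ f (@nopen R Q)) => // _ [U oU <-].
rewrite setTI; apply: measurable_realfun.open_measurable; rewrite openE => s /oU [e e0 Ue].
exists e => //= t; rewrite /ball_ /= => st; apply: Ue.
by apply: le_lt_trans (lf s t) _; rewrite lte_fin.
Qed.

Lemma arc_pt_measurable (a : arcs Q) :
  measurable_fun [set: R] (arc_pt a : R -> borel_network Q).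
Proof. by apply: lipschitz_measurable => s t; exact: dist_arc_pt. Qed.

Definition length_measure (A : set (borel_network Q)) : \bar R :=
  (\sum_(a : arcs Q)
    lebesgue_measure [set s : R | A (arc_pt a s) /\ (0 < s < len a)%R])%E.

Let arc_measure (a : arcs Q) : {measure set (borel_network Q) -> \bar R}.
Proof.
refine [the measure _ _ of pushforward
  [the measure _ _ of mrestr lebesgue_measure (measurable_itv `]0%R, len a[)]
  (arc_pt a : R -> borel_network Q)].
exact: arc_pt_measurable.
Defined.

Let length_measureE A : length_measure A = (\sum_(a : arcs Q) arc_measure a A)%E.
Proof.
by apply: eq_bigr => a _; congr lebesgue_measure.
Qed.

Let length_measure0 : length_measure set0 = 0%E.
Proof. by rewrite length_measureE big1// => a _; rewrite measure0. Qed.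

Let length_measure_ge0 A : (0 <= length_measure A)%E.
Proof. by rewrite length_measureE sume_ge0. Qed.

Let length_measure_sigma_additive : semi_sigma_additive length_measure.
Proof.
move=> F mF tF mUF; rewrite [X in _ --> X](_ : _ =
    lim ((fun n => \sum_(0 <= i < n) length_measure (F i))%E @ \oo)).
  apply: is_cvg_ereal_nneg_natsum => k _; exact: length_measure_ge0.
transitivity (lim ((fun n => \sum_(0 <= i < n)
    \sum_(a : arcs Q) arc_measure a (F i))%E @ \oo)).
  rewrite nneseries_sum// length_measureE; apply: eq_bigr => /= a _.
  exact: (measure_semi_bigcup (arc_measure a)).
by apply: eq_eseriesr => i _; rewrite length_measureE.
Qed.

HB.instance Definition _ := isMeasure.Build _ _ _ length_measure
  length_measure0 length_measure_ge0 length_measure_sigma_additive.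

Definition total_length : R := fine (length_measure setT).

End Lipschitz.

Section Walks.
Context {R : realType}.
Variable Q : network R.

Definition walk_length (w : seq (dart Q)) : R := \sum_(e <- w) len e.1.

Definition composable : rel (dart Q) := [rel e f | dart_tgt e == dart_src f].

Definition circuit (w : seq (dart Q)) : bool :=
  [&& w != [::], uniq [seq e.1 | e <- w] & cycle composable w].

Definition girth : \bar R := ereal_inf [set (walk_length w)%:E | w in circuit].

(* The point reached after travelling the distance [s] along the dart [e]. *)
Definition dart_pt (e : dart Q) (s : R) : npoint Q :=
  arc_pt e.1 (if e.2 then s else len e.1 - s).

End Walks.

Section ClosedPaths.
Context {R : realType}.

(* Only the values of [closed_fun] on [0, period] matter. *)
Record closed_path (Q : network R) := ClosedPath {
  period : R;
  period_gt0 : 0 < period;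
  closed_fun :> R -> npoint Q;
  closed_unit_speed : forall s t, 0 <= s <= period -> 0 <= t <= period ->
    (dist (closed_fun s) (closed_fun t) <= `|s - t|%:E)%E;
  closed_funE : closed_fun 0 = closed_fun period }.

Variable Q : network R.

(* A unit speed path in the sense of [closed_unit_speed] may pause, so that its
   duration only bounds its length; this does not affect the infimum. *)
Definition covering_length : \bar R :=
  ereal_inf [set (period S)%:E |
    S in [set S : closed_path Q |
      forall x, exists2 t, 0 <= t <= period S & S t = x]].

Definition real_mod (t L : R) : R := t - (Num.floor (t / L))%:~R * L.

Definition rotate_path (S : closed_path Q) (D t : R) : npoint Q :=
  S (real_mod (t + D) (period S)).

(* A closed walk [w] (seen cyclically, so that its last and first darts are
   also in succession) traversed at unit speed by [S], up to the choice of the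
   initial point of the closed path. *)
Definition traverses (S : closed_path Q) (w : seq (dart Q)) : Prop :=
  [/\ cycle (@composable R Q) w, period S = walk_length w &
    exists2 D, 0 <= D <= period S &
      forall w1 e w2 s, w = w1 ++ e :: w2 -> 0 <= s <= len e.1 ->
        rotate_path S D (walk_length w1 + s) = dart_pt e s].

Definition double_tour (S : closed_path Q) : Prop :=
  exists w, [/\ traverses S w,
    forall a : arcs Q, count (fun e : dart Q => e.1 == a) w = 2%N &
    cycle [rel e f | f != dart_rev e] w].

End ClosedPaths.

Section RealMod.
Context {R : realType}.
Variable L : R.
Hypothesis L0 : 0 < L.

Lemma real_mod_itv (t : R) : 0 <= real_mod t L < L.
Proof.
have /andP[h1 h2] := Num.Theory.real_floor_itv (num_real (t / L)).
rewrite /real_mod subr_ge0 -ler_pdivlMr// h1/=.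
rewrite ltrBlDr -[X in X + _]mul1r -mulrDl -ltr_pdivrMr//.
by move: h2; rewrite intrD addrC.
Qed.

End RealMod.

Section Rotate.
Context {R : realType} {Q : network R}.
Variable S : closed_path Q.

Lemma rotate_path_lip D E t u :
  (dist (rotate_path S D t) (rotate_path S E u) <=
   `|(t + D) - (u + E)|%:E)%E.
Proof.
rewrite /rotate_path; set x := t + D; set y := u + E.
wlog xy : x y / x <= y.
  by move=> H; case: (leP x y) => [/H//|/ltW/H]; rewrite dist_sym distrC.
have L0 := period_gt0 S; set L := period S.
have := real_mod_itv L0 x; have := real_mod_itv L0 y.
rewrite -/L => /andP[y0 yL] /andP[x0 xL].
have fxy : (Num.floor (x / L) <= Num.floor (y / L))%R.
  by apply: Num.Theory.le_floor; rewrite ler_pM2r ?invr_gt0.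
move: fxy; rewrite le_eqVlt => /orP[/eqP fxy|fxy].
  have <- : real_mod x L - real_mod y L = x - y.
    by rewrite /real_mod fxy opprB addrACA [_ + (_ - _)]addrC; lra.
  by apply: closed_unit_speed; rewrite ?x0 ?y0 ltW.
have iL z : 0 <= z -> z < L -> 0 <= z <= L by move=> -> /ltW.
have i0 : (0 : R) <= 0 <= L by apply/andP; split => //; exact: ltW.
have iLL : 0 <= L <= L by apply/andP; split => //; exact: ltW.
have h1 : (dist (S (real_mod x L)) (S L) <= (L - real_mod x L)%:E)%E.
  have := closed_unit_speed (iL _ x0 xL) iLL.
  by rewrite distrC ger0_norm// subr_ge0 ltW.
have h2 : (dist (S L) (S (real_mod y L)) <= (real_mod y L)%:E)%E.
  have := closed_unit_speed i0 (iL _ y0 yL).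
  by rewrite closed_funE sub0r normrN ger0_norm.
apply: le_trans (dist_triangle h1 h2) _; rewrite lee_fin.
rewrite distrC ger0_norm ?subr_ge0// /real_mod.
have : (Num.floor (x / L))%:~R + 1 <= (Num.floor (y / L))%:~R :> R.
  by rewrite -[1 in X in X <= _]/(1%:~R) -intrD ler_int -ltzD1 ltrD2r.
rewrite -(ler_pM2r L0) -/L mulrDl => h; nra.
Qed.

End Rotate.

Record patrol_fun (R : realType) (Q : network R) := PatrolFun {
  patrol_pos :> {nonneg R} -> npoint Q;
  patrol_unit_speed : forall s t,
    (dist (patrol_pos s) (patrol_pos t) <= `|s%:num - t%:num|%:E)%E }.

HB.instance Definition _ (R : realType) (Q : network R) :=
  gen_eqMixin (patrol_fun Q).
HB.instance Definition _ (R : realType) (Q : network R) :=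
  gen_choiceMixin (patrol_fun Q).

Definition still_patrol {R : realType} (Q : network R) : patrol_fun Q.
Proof.
exists (fun=> at_node (base_node Q)) => s t.
by apply: le_trans (dist_refl _) _; rewrite lee_fin.
Defined.

HB.instance Definition _ (R : realType) (Q : network R) :=
  isPointed.Build (patrol_fun Q) (still_patrol Q).

(* The sigma-algebra generated by the positions at the various times, which is
   also the Borel sigma-algebra of locally uniform convergence. *)
Definition position_events {R : realType} (Q : network R) :
    set (set (patrol_fun Q)) :=
  [set E | exists t : {nonneg R}, exists2 B : set (borel_network Q),
     measurable B & E = [set S : patrol_fun Q | B (S t)]].

Notation patrol Q := (g_sigma_algebraType (@position_events _ Q)).

Definition time (R : realType) : Type := {nonneg R}.
HB.instance Definition _ (R : realType) := Choice.copy (time R) {nonneg R}.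
HB.instance Definition _ (R : realType) := isPointed.Build (time R) (0%:nng).

Definition time_val {R : realType} (t : time R) : R := (t : {nonneg R})%:num.

Notation borel_time R := (g_sigma_algebra_preimageType (@time_val R)).

Section Strategies.
Context {R : realType}.
Variable Q : network R.

Definition attack_at (M : {nonneg R}) (x : borel_network Q) :
  borel_network Q * borel_time R := (x, M).

Lemma attack_at_measurable M :
  measurable_fun [set: borel_network Q] (attack_at M).
Proof.
by apply: measurable_fun_pair; [exact: measurable_id|exact: measurable_cst].
Qed.

HB.instance Definition _ M :=
  isMeasurableFun.Build _ _ _ _ (attack_at M) (attack_at_measurable M).

(* The second argument of [mnormalize] is only used when [length_measure] has
   total mass 0, that is, when there is no arc. *)
Definition uniform_point : probability (borel_network Q) R :=
  mnormalize (@length_measure R Q)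
    (dirac (at_node (base_node Q) : borel_network Q)).

Definition uniform_attack (M : {nonneg R}) :
    probability (borel_network Q * borel_time R)%type R :=
  distribution uniform_point (attack_at M).

Lemma shifted_unit_speed (S : closed_path Q) (D : R) (s t : {nonneg R}) :
  (dist (rotate_path S D s%:num) (rotate_path S D t%:num) <=
   `|s%:num - t%:num|%:E)%E.
Proof.
apply: le_trans (rotate_path_lip _ _ _ _ _) _.
by rewrite opprD addrACA subrr addr0.
Qed.

Definition shifted_patrol (S : closed_path Q) (D : measurableTypeR R) :
    patrol Q :=
  PatrolFun (shifted_unit_speed S D).

Lemma shifted_patrol_measurable S :
  measurable_fun [set: measurableTypeR R] (shifted_patrol S).
Proof.
apply: (@measurability _ _ _ (patrol Q) _ (shifted_patrol S)
  (@position_events R Q)) => //.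
move=> _ [_ [t [B mB ->]] <-].
have mS : measurable_fun [set: R]
    (fun D => rotate_path S D t%:num : borel_network Q).
  apply: lipschitz_measurable => D E.
  apply: le_trans (rotate_path_lip _ _ _ _ _) _.
  by rewrite opprD addrACA subrr add0r.
exact: mS.
Qed.

HB.instance Definition _ S :=
  isMeasurableFun.Build _ _ _ _ (shifted_patrol S) (shifted_patrol_measurable S).

Definition randomized_extension (S : closed_path Q) : probability (patrol Q) R :=
  distribution (uniform_prob (period_gt0 S)) (shifted_patrol S).

End Strategies.

Section Game.
Context {R : realType}.
Variable Q : network R.
Variable alpha : R.

Definition intercepts (S : patrol Q) (a : borel_network Q * borel_time R) :
    Prop :=
  exists t : {nonneg R},
    time_val a.2 <= t%:num <= time_val a.2 + alpha /\ S t = a.1.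

Local Notation mixed_patrol := (probability (patrol Q) R).
Local Notation mixed_attack :=
  (probability (borel_network Q * borel_time R)%type R).

Definition payoff (P : mixed_patrol) (A : mixed_attack) : \bar R :=
  (P \x A)%E [set w | intercepts w.1 w.2].

Definition game_value (V : \bar R) : Prop :=
  ereal_sup [set ereal_inf [set payoff P A | A in [set: mixed_attack]] |
    P in [set: mixed_patrol]] = V /\
  ereal_inf [set ereal_sup [set payoff P A | P in [set: mixed_patrol]] |
    A in [set: mixed_attack]] = V.

Definition optimal_patrol (P : mixed_patrol) : Prop :=
  exists2 V, game_value V & forall A : mixed_attack, (V <= payoff P A)%E.

Definition optimal_attack (A : mixed_attack) : Prop :=
  exists2 V, game_value V & forall P : mixed_patrol, (payoff P A <= V)%E.

End Game.

(* Main.v *)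
(* Attacker: a unit speed patrol is 1-Lipschitz, so during an attack it visits
   a set of length at most alpha, which the uniform attack hits with
   probability at most alpha / mu. Patroller: S2 has period 2 mu and meets every
   point at two times or more. A closed walk without backtracking contains a
   circuit, so both gaps between two such times on the circle of length 2 mu are
   at least the girth, hence at least alpha. The shifts of S2 that intercept a
   given attack thus contain two disjoint arcs of length alpha of that circle,
   which gives the probability 2 alpha / (2 mu). Fubini exchanges the two mixed
   strategies; it requires the set of intercepted pairs to be measurable. *)
Require Import Defs.
From mathcomp Require Import all_boot all_order all_algebra.
From mathcomp Require Import all_classical all_reals all_analysis.
From mathcomp Require Import lra ring zify.

Set Implicit Arguments.
Unset Strict Implicit.
Unset Printing Implicit Defensive.

Import Order.TTheory GRing.Theory Num.Theory.
Import numFieldNormedType.Exports.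

Local Open Scope classical_set_scope.
Local Open Scope ring_scope.

(** * Distance on a network *)

Section Distance.
Context {R : realType} {Q : network R}.
Implicit Types x y z : npoint Q.

Lemma dist_ge0 x y : (0 <= dist x y)%E.
Proof.
apply: le_ereal_inf_tmp => _ [l + <-].
by elim=> // b s t u k _ _ _; rewrite !lee_fin => k0; rewrite addr_ge0.
Qed.

(** Each segment of a path changes [f] by at most its length, so the total change is at most the
    length of the path. Lower bounds on [dist] come from choosing a suitable [f]. *)
Lemma dist_lipschitz (f : npoint Q -> R) :
  (forall a s t, 0 <= s <= len a -> 0 <= t <= len a ->
    `|f (arc_pt a s) - f (arc_pt a t)| <= `|s - t|) ->
  forall x y, (`|f x - f y|%:E <= dist x y)%E.
Proof.
move=> flip x y; apply: le_ereal_inf_tmp => _ [l xy <-]; rewrite lee_fin.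
elim: xy => [u|a s t u k hs ht _ IH]; first by rewrite subrr normr0.
apply: le_trans (lerD (flip a s t hs ht) IH).
rewrite (_ : f _ - f u = (f (arc_pt a s) - f (arc_pt a t)) +
  (f (arc_pt a t) - f u)) ?ler_normD//.
by rewrite addrA subrK.
Qed.

(** The distance along [a] to the coordinate [s0], truncated at [m]. If both ends of [a] are at
    least [m] away from [s0], the constant [m] extends it continuously to the rest of the
    network. *)
Definition tent (a : arcs Q) (s0 m : R) x : R :=
  if x is @on_arc _ _ b s _ then
    if b == a then Num.min `|s - s0| m else m
  else m.

Lemma tent_arc_pt a (s0 m s : R) : m <= s0 -> m <= len a - s0 ->
  0 <= s <= len a -> tent a s0 m (arc_pt a s) = Num.min `|s - s0| m.
Proof.
move=> m0 m1 /andP[]; rewrite le_eqVlt => /predU1P[<- _|s0'].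
  rewrite arc_pt_src//= sub0r normrN min_r//.
  by apply: le_trans m0 (ler_norm _).
rewrite le_eqVlt => /predU1P[->|s1].
  rewrite arc_pt_tgt//= min_r//; apply: le_trans m1 (ler_norm _).
have h : 0 < s < len a by rewrite s0'.
by rewrite (arc_pt_in h) /= eqxx.
Qed.

Lemma tent_arc_pt_neq a b (s0 m s : R) : b != a -> tent a s0 m (arc_pt b s) = m.
Proof.
move=> ba; case: (boolP (0 < s < len b)) => [h|].
  by rewrite (arc_pt_in h)/= (negbTE ba).
rewrite negb_and -!leNgt => /orP[?|?].
  by rewrite arc_pt_src.
by rewrite arc_pt_tgt.
Qed.

Lemma tent_dist a (s0 m : R) : m <= s0 -> m <= len a - s0 -> forall x y,
  (`|tent a s0 m x - tent a s0 m y|%:E <= dist x y)%E.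
Proof.
move=> m0 m1; apply: dist_lipschitz => b s t hs ht.
have [ba|ba] := eqVneq b a; last by rewrite !tent_arc_pt_neq// subrr normr0.
subst b; rewrite !tent_arc_pt//.
have h1 := ler_normD (s - t) (t - s0); rewrite addrA subrK in h1.
have h2 := ler_normD (t - s) (s - s0); rewrite addrA subrK (distrC t s) in h2.
rewrite ler_norml !minEle.
have h3 := normr_ge0 (s - t).
by case: (leP `|s - s0| m) => h4; case: (leP `|t - s0| m) => h5;
  apply/andP; split; lra.
Qed.

(** A path too short to reach an end of [a] stays on [a]: the tent of height [m > r] vanishes at
    [s0], equals [m] off [a], and is 1-Lipschitz. *)
Lemma dist_on_arc a (s0 : R) y (r : R) : (dist (arc_pt a s0) y <= r%:E)%E ->
  r < s0 -> r < len a - s0 ->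
  exists2 s, y = arc_pt a s & `|s - s0| <= r /\ 0 < s < len a.
Proof.
move=> dr r0 r1; pose m := Num.min s0 (len a - s0).
have rm : r < m by rewrite lt_min r0.
have hm0 : m <= s0 by rewrite ge_min lexx.
have hm1 : m <= len a - s0 by rewrite ge_min lexx orbT.
have := le_trans (tent_dist hm0 hm1 (arc_pt a s0) y) dr.
have rge0 : 0 <= r.
  by rewrite -lee_fin; apply: le_trans dr; exact: dist_ge0.
rewrite tent_arc_pt//; last by apply/andP; split; lra.
rewrite subrr normr0 min_l ?sub0r ?normrN ?lee_fin; last lra.
case: y {dr} => [v|b s h] /=.
  by rewrite ger0_norm; lra.
case: eqVneq => [ba|_]; last by rewrite ger0_norm; lra.
subst b; rewrite ger0_norm ?le_min ?normr_ge0//=; last lra.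
rewrite ge_min [m <= r]leNgt rm orbF => sr.
by exists s => //; rewrite (arc_pt_in h).
Qed.

(** A node other than [src a0] is joined to it by a path, whose first dart leaves that node. The arc
    [a0] excludes the network reduced to one node. *)
Lemma arc_ptP x (a0 : arcs Q) : exists a s, 0 <= s <= len a /\ x = arc_pt a s.
Proof.
case: x => [v|a s h]; last first.
  exists a, s; rewrite (arc_pt_in h); split => //.
  by move/andP: h => [/ltW -> /ltW ->].
have inc (e : dart Q) :
    exists a s, 0 <= s <= len a /\ at_node (dart_src e) = arc_pt a s.
  have l0 := ltW (len_gt0 e.1).
  exists e.1; case: e l0 => a [] /= l0.
    by exists 0; rewrite lexx l0 arc_pt_src.
  by exists (len a); rewrite lexx l0 arc_pt_tgt.
have /connectP[p] := network_connected v (src a0).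
case: p => [_ /= <-|u p /= /andP[/existsP[e /andP[/eqP <- _]] _] _].
  exact: (inc (a0, true)).
exact: inc.
Qed.

Lemma path_length_nodes (u v : nodes Q) :
  exists l, path_length (at_node u) (at_node v) l.
Proof.
have /connectP[p] := network_connected u v.
elim: p u => [u _ /= ->|w p IH u /= /andP[+ /IH h] /h [l wl]].
  by exists 0; exact: path_nil.
move=> /existsP[[a b] /andP[/eqP <- /eqP hw]].
have l0 := ltW (len_gt0 a).
move: hw wl; rewrite /dart_src /dart_tgt; case: b => /= <- wl.
- exists (`|0 - len a| + l); rewrite -(@arc_pt_src _ _ a 0)//.
  by apply: path_cons; rewrite ?lexx ?l0//= arc_pt_tgt.
- exists (`|len a - 0| + l); rewrite -(@arc_pt_tgt _ _ a (len a))//.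
  by apply: path_cons; rewrite ?lexx ?l0//= arc_pt_src.
Qed.

Lemma path_length_node x : exists v l, path_length x (at_node v) l.
Proof.
case: x => [v|a s h]; first by exists v, 0; exact: path_nil.
exists (src a), (`|s - 0| + 0); rewrite -(arc_pt_in h).
have l0 := ltW (len_gt0 a); move/andP: h => [s0 s1].
apply: path_cons; rewrite ?lexx ?l0 ?ltW//.
by rewrite arc_pt_src//; exact: path_nil.
Qed.

Lemma dist_fin_num x y : dist x y \is a fin_num.
Proof.
rewrite ge0_fin_numE ?dist_ge0//.
have [u [l xu]] := path_length_node x.
have [v [m yv]] := path_length_node y.
have [k uv] := path_length_nodes u v.
have xy := path_length_cat (path_length_cat xu uv) (path_length_sym yv).
apply: (@le_lt_trans _ _ (l + k + m)%:E); last exact: ltry.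
by apply: ereal_inf_lbound; exists (l + k + m).
Qed.

(** If one point is interior to an arc, this is [dist_on_arc] with radius 0. Two nodes are separated
    by a Lipschitz function. *)
Lemma dist_eq0 x y : (dist x y <= 0)%E -> x = y.
Proof.
have onarc a s (h : 0 < s < len a) z :
    (dist (on_arc h) z <= 0)%E -> on_arc h = z.
  move=> d0; have [s0 s1] := andP h; rewrite -(arc_pt_in h) in d0 *.
  have [||t -> [ts _]] := dist_on_arc d0 _ _; [lra|lra|].
  by congr arc_pt; apply/eqP; rewrite -subr_eq0 -normr_eq0 distrC eq_le ts/=.
case: x => [u|a s h]; last exact: onarc.
case: y => [v|a s h]; last by rewrite dist_sym => /onarc ->.
(* [K] dominates every [(len a)^-1], the largest slope that a 0-1 function on the nodes can have
   when interpolated along [a]. *)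
pose K : R := 1 + \sum_(a : arcs Q) (len a)^-1.
have S0 : 0 <= \sum_(a : arcs Q) (len a)^-1.
  by apply: sumr_ge0 => a _; rewrite invr_ge0 ltW ?len_gt0.
have K0 : 0 < K by rewrite /K; lra.
have K1 (a : arcs Q) : K^-1 * (len a)^-1 <= 1.
  rewrite mulrC ler_pdivrMr// mul1r /K (bigD1 a)//= addrCA lerDl addr_ge0//.
  by apply: sumr_ge0 => b _; rewrite invr_ge0 ltW ?len_gt0.
pose c (w : nodes Q) : R := (w == u)%:R.
(* The indicator [c] of [u], interpolated affinely along the arcs and scaled
   down to slope at most 1, separates the nodes. *)
pose f z := K^-1 * match z with at_node w => c w
  | @on_arc _ _ a s _ => c (src a) + (c (tgt a) - c (src a)) * (s / len a) end.
have fE a s : 0 <= s <= len a ->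
    f (arc_pt a s) = K^-1 * (c (src a) + (c (tgt a) - c (src a)) * (s / len a)).
  move=> /andP[]; rewrite le_eqVlt => /predU1P[<- _|s0].
    by rewrite arc_pt_src// mul0r mulr0 addr0.
  rewrite le_eqVlt => /predU1P[->|s1].
    by rewrite arc_pt_tgt// divff ?gt_eqF ?len_gt0// mulr1 addrC subrK.
  have h : 0 < s < len a by rewrite s0.
  by rewrite (arc_pt_in h).
have flip a s t : 0 <= s <= len a -> 0 <= t <= len a ->
    `|f (arc_pt a s) - f (arc_pt a t)| <= `|s - t|.
  move=> hs ht; rewrite !fE// -mulrBr opprD addrACA subrr add0r -mulrBr -mulrBl.
  rewrite !normrM [`|(len a)^-1|]gtr0_norm ?invr_gt0 ?len_gt0//.
  rewrite [`|K^-1|]gtr0_norm ?invr_gt0//.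
  rewrite (_ : _ * _ = K^-1 * (len a)^-1 * `|c (tgt a) - c (src a)| * `|s - t|);
    last by ring.
  rewrite -[leRHS]mul1r ler_wpM2r//.
  have c1 : `|c (tgt a) - c (src a)| <= 1.
    by rewrite /c; case: eqP; case: eqP;
      rewrite ?(subrr, subr0, sub0r, normr0, normrN, normr1).
  by rewrite -[leRHS]mul1r ler_pM// ?mulr_ge0 ?invr_ge0// ltW// len_gt0.
move=> /(le_trans (dist_lipschitz flip (at_node u) (at_node v))).
rewrite lee_fin normr_le0 /f /= -mulrBr mulf_eq0 invr_eq0 gt_eqF//= /c eqxx.
by case: (v =P u) => [->//|_]; rewrite subr0 oner_eq0.
Qed.

End Distance.

(** * Non-backtracking walks *)

Section Splitting.
Variable T : Type.

Lemma has_split (p : pred T) (s : seq T) : has p s ->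
  exists u x v, s = u ++ x :: v /\ p x.
Proof.
elim: s => [//|x s IH] /=; case: (boolP (p x)) => [px _|_ /= /IH].
  by exists [::], x, s.
by move=> [u [y [v [-> py]]]]; exists (x :: u), y, v.
Qed.

Lemma count_split (p : pred T) (s : seq T) : (1 < count p s)%N ->
  exists u x v y z, s = u ++ x :: v ++ y :: z /\ p x /\ p y.
Proof.
elim: s => [//|x s IH] /=; case: (boolP (p x)) => [px|_]; last first.
  rewrite add0n => /IH[u [x' [v [y [z [-> pp]]]]]].
  by exists (x :: u), x', v, y, z.
rewrite add1n ltnS -has_count => /has_split[v [y [z [-> py]]]].
by exists [::], x, v, y, z.
Qed.

Lemma not_uniq_split (T' : eqType) (h : T -> T') (s : seq T) :
  ~~ uniq (map h s) ->
  exists u x v y z, s = u ++ x :: v ++ y :: z /\ h x = h y.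
Proof.
elim: s => [//|x s IH] /=; rewrite negb_and negbK.
case: (boolP (h x \in map h s)) => /= [hx _|_ /IH]; last first.
  by move=> [u [x' [v [y [z [-> pp]]]]]]; exists (x :: u), x', v, y, z.
have : has (fun y => h y == h x) s.
  by rewrite -(has_map h (pred1 (h x))) has_pred1.
by move=> /has_split[v [y [z [-> /eqP hy]]]]; exists [::], x, v, y, z.
Qed.

End Splitting.

Lemma sorted_infix (T : eqType) (e : rel T) u v w :
  sorted e (u ++ v ++ w) -> sorted e v.
Proof. by move=> /infix_sorted; apply; apply/infixP; exists u, w. Qed.

(** * Closed walks, the girth and the visits of a double tour *)

Section Walk.
Context {R : realType} {Q : network R}.
Implicit Types (e f : dart Q) (w u v : seq (dart Q)).

Definition no_backtrack : rel (dart Q) := [rel e f | f != dart_rev e].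

Lemma same_arc e f : e.1 = f.1 -> f = e \/ f = dart_rev e.
Proof.
by case: e f => a [] [b []] /= ->; [left|right|right|left].
Qed.

Lemma dart_src_rev e : dart_src (dart_rev e) = dart_tgt e.
Proof. by case: e => a []. Qed.

Lemma walk_length_cat u v :
  walk_length (u ++ v) = walk_length u + walk_length v.
Proof. by rewrite /walk_length big_cat. Qed.

Lemma walk_length_cons e v : walk_length (e :: v) = len e.1 + walk_length v.
Proof. by rewrite /walk_length big_cons. Qed.

Lemma walk_length_ge0 w : 0 <= walk_length w.
Proof. by apply: sumr_ge0 => e _; exact/ltW/len_gt0. Qed.

(** The walk [v] starts at [dart_tgt e], and it ends there too, since [dart_rev e] leaves from that
    node. *)
Lemma cycle_between_reversals e v :
  sorted (@composable R Q) (e :: v ++ [:: dart_rev e]) ->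
  cycle (@composable R Q) v.
Proof.
case: v => //= g v /andP[/eqP eg]; rewrite cats1 !rcons_path => /andP[-> /=].
by rewrite /composable /= dart_src_rev eg.
Qed.

(** Induction on the number of darts: a repeated arc cuts out a shorter closed walk, [e :: v] if
    both directions agree and [v] otherwise. Backtracking is excluded inside [w] but not at its
    closing point, where these pieces may turn back. *)
Lemma girth_le w : w != [::] -> cycle (@composable R Q) w ->
  sorted no_backtrack w -> (girth Q <= (walk_length w)%:E)%E.
Proof.
have [n] := ubnP (size w); elim: n w => // n IH w wn w0 cw nb.
have [uw|] := boolP (uniq [seq e.1 | e <- w]).
  by apply: ereal_inf_lbound; exists w => //; apply/and3P.
move=> /not_uniq_split[u [e [v [f [z [wE ef]]]]]].
have sw : sorted (@composable R Q) w.
  by case: w cw {wn w0 nb wE} => //= g w; rewrite rcons_path => /andP[].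
have sz : size w = (size u + (size v + (size z).+1).+1)%N.
  by rewrite wE size_cat /= size_cat.
have evf : (w = u ++ (e :: v ++ [:: f]) ++ z) by rewrite wE /= -catA.
have wl : walk_length (e :: v) <= walk_length w.
  rewrite wE walk_length_cat walk_length_cons.
  rewrite [walk_length (_ :: _)]walk_length_cons.
  rewrite walk_length_cat; have := walk_length_ge0 u.
  by have := walk_length_ge0 (f :: z); lra.
have [fE|fE] := same_arc ef; subst f.
  apply: le_trans (IH (e :: v) _ _ _ _) _ => //.
  - by move: wn; rewrite sz /=; lia.
  - rewrite /= -cats1; move: sw; rewrite evf; exact: sorted_infix.
  - by move: nb; rewrite wE -cat_cons; exact: sorted_infix.
(* Otherwise [e] would be followed at once by its reversal. *)
have v0 : v != [::].
  apply/eqP => v0; move: nb; rewrite evf v0 => /sorted_infix /=.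
  by rewrite /no_backtrack /= eqxx.
apply: le_trans (IH v _ v0 _ _) _ => //.
- by move: wn; rewrite sz; lia.
- apply: (@cycle_between_reversals e).
  by move: sw; rewrite evf; exact: sorted_infix.
- by move: nb; rewrite wE -cat_rcons; exact: sorted_infix.
- rewrite lee_fin; apply: le_trans wl; rewrite walk_length_cons lerDr.
  exact/ltW/len_gt0.
Qed.

(* The distance along [e] at which the point of coordinate [s] is met. *)
Definition dart_coord e (s : R) : R := if e.2 then s else len e.1 - s.

Lemma dart_coordP e s : 0 <= s <= len e.1 ->
  0 <= dart_coord e s <= len e.1 /\ dart_pt e (dart_coord e s) = arc_pt e.1 s.
Proof.
rewrite /dart_coord /dart_pt; case: ifP => _ hs; first by split.
by rewrite subKr; split => //; lra.
Qed.

(** The bound is the distance travelled from the point of coordinate [s] on [e] to the same point on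
    [f]. It is the length of [e :: v] if the directions agree; otherwise it is that of [v] plus
    twice the rest of [e] after the point. *)
Lemma girth_le_return e v f (s : R) : e.1 = f.1 -> 0 <= s <= len e.1 ->
  sorted (@composable R Q) (e :: v ++ [:: f]) ->
  sorted no_backtrack (e :: v ++ [:: f]) ->
  (girth Q <= (len e.1 + walk_length v + dart_coord f s - dart_coord e s)%:E)%E.
Proof.
move=> ef hs sc nb; have [fE|fE] := same_arc ef; subst f.
  apply: le_trans (@girth_le (e :: v) _ _ _) _ => //.
  - by rewrite /= -cats1.
  - exact: (@sorted_infix _ _ [::] (e :: v) [:: e]).
  - by rewrite lee_fin walk_length_cons addrK.
apply: le_trans (@girth_le v _ _ _) _.
- by apply: contraL nb => /eqP ->; rewrite /no_backtrack /= eqxx.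
- exact: cycle_between_reversals sc.
- exact: (@sorted_infix _ _ [:: e] v [:: dart_rev e]).
- rewrite lee_fin /dart_coord /=; case: (e.2) => /=; lra.
Qed.

Lemma two_visits (S : closed_path Q) (alpha : R) (a : arcs Q) (s : R) :
  (alpha%:E <= girth Q)%E -> double_tour S -> 0 <= s <= len a ->
  exists t1 t2, [/\ t1 + alpha <= t2, t2 + alpha <= t1 + period S,
    S (real_mod t1 (period S)) = arc_pt a s &
    S (real_mod t2 (period S)) = arc_pt a s].
Proof.
move=> ag [w [[cw pw [D D0 Sw]] cnt nb]] hs.
have /count_split : (1 < count (fun e : dart Q => e.1 == a) w)%N by rewrite cnt.
move=> [u [e [v [f [z [wE [/eqP ea /eqP fa]]]]]]].
have ef : e.1 = f.1 by rewrite ea.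
(* Rotating [w] to start at [e] and repeating [e] at the end turns both gaps, from [e] to [f] and
   from [f] back to [e], into contiguous stretches of one list. *)
have sorted_rot (r : rel (dart Q)) : cycle r w ->
    sorted r (e :: v ++ f :: z ++ u ++ [:: e]).
  rewrite wE -(rot_cycle (size u)) rot_size_cat /=.
  by rewrite -cats1 -?catA /= -?catA.
have hse : 0 <= s <= len e.1 by rewrite ea.
have hsf : 0 <= s <= len f.1 by rewrite fa.
have [e01 eE] := dart_coordP hse; have [f01 fE] := dart_coordP hsf.
have Pe := Sw u e (v ++ f :: z) _ wE e01.
have wE' : w = (u ++ e :: v) ++ f :: z by rewrite wE -catA.
have Pf := Sw _ f z _ wE' f01.
(* [S] begins the walk at time [D]. The two times are not reduced modulo the period, so that they
   stay ordered. *)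
exists (walk_length u + dart_coord e s + D),
  (walk_length (u ++ e :: v) + dart_coord f s + D); split.
- have := le_trans ag (girth_le_return (v := v) ef hse _ _).
  rewrite lee_fin walk_length_cat walk_length_cons => H.
  apply: le_trans (_ : _ <= walk_length u + dart_coord e s + D + (
    len e.1 + walk_length v + dart_coord f s - dart_coord e s)) _; last lra.
  rewrite lerD2l; apply: H.
  + apply: (@sorted_infix _ _ [::] _ (z ++ u ++ [:: e])).
    by rewrite /= -catA; exact: sorted_rot.
  + apply: (@sorted_infix _ _ [::] _ (z ++ u ++ [:: e])).
    by rewrite /= -catA; exact: sorted_rot.
- have := le_trans ag (girth_le_return (v := z ++ u) (esym ef) hsf _ _).
  rewrite lee_fin pw wE !(walk_length_cat, walk_length_cons) => H.
  have {}H : alpha <= len f.1 + (walk_length z + walk_length u) +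
      dart_coord e s - dart_coord f s.
    apply: H.
    + apply: (@sorted_infix _ _ (e :: v) _ [::]).
      by rewrite cats0 /= -catA; exact: sorted_rot.
    + apply: (@sorted_infix _ _ (e :: v) _ [::]).
      by rewrite cats0 /= -catA; exact: sorted_rot.
  lra.
- by rewrite -ea -eE -Pe.
- by rewrite -fa -fE -Pf.
Qed.

End Walk.

(** * Measurability of interception *)

Section RealDist.
Context {R : realType} {Q : network R}.
Implicit Types x y z : npoint Q.

Definition rdist x y : R := fine (dist x y).

Lemma distE x y : dist x y = (rdist x y)%:E.
Proof. by rewrite fineK// dist_fin_num. Qed.

Lemma rdist_triangle x y z : rdist x z <= rdist x y + rdist y z.
Proof.
by rewrite -lee_fin -distE; apply: (@dist_triangle _ _ _ y); rewrite distE.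
Qed.

Lemma rdist_sym x y : rdist x y = rdist y x.
Proof. by rewrite /rdist dist_sym. Qed.

Lemma rdist_eq0 x y : rdist x y <= 0 -> x = y.
Proof. by rewrite -lee_fin -distE; exact: dist_eq0. Qed.

Lemma rdist_arc_pt a s t :
  rdist (arc_pt a s : npoint Q) (arc_pt a t) <= `|s - t|.
Proof. by rewrite -lee_fin -distE dist_arc_pt. Qed.

Lemma rdist_patrol (S : patrol_fun Q) s t :
  rdist (S s) (S t) <= `|s%:num - t%:num|.
Proof. by rewrite -lee_fin -distE patrol_unit_speed. Qed.

Lemma measurable_rball z (r : R) :
  measurable ([set x | rdist x z < r] : set (borel_network Q)).
Proof.
apply: sub_sigma_algebra => x /= xr.
exists (r - rdist x z); first by rewrite subr_gt0.
move=> y; rewrite distE lte_fin ltrBrDr => h /=.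
apply: le_lt_trans (rdist_triangle y x z) _.
by rewrite (rdist_sym y x).
Qed.

Lemma arc_pt_inj (a b : arcs Q) s t : 0 < s < len a -> 0 < t < len b ->
  arc_pt a s = arc_pt b t -> a = b /\ s = t.
Proof.
by move=> hs ht; rewrite (arc_pt_in hs) (arc_pt_in ht); case.
Qed.

(** Reflection extends a patrol to all real times without increasing its speed. *)
Definition abs_time (u : R) : {nonneg R} := NngNum (normr_ge0 u).

(** By compactness the distance to [x] attains its minimum on the attack interval, and approximate
    hits of arbitrary precision force this minimum to be 0. *)
Lemma patrol_hits (S : patrol_fun Q) x (tau alpha : R) :
  0 <= tau -> 0 <= alpha ->
  (forall e : R, 0 < e -> exists t : {nonneg R},
    tau - e <= t%:num <= tau + alpha + e /\ rdist (S t) x < e) ->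
  exists t : {nonneg R}, tau <= t%:num <= tau + alpha /\ S t = x.
Proof.
move=> tau0 alpha0 H; pose h (u : R) := rdist (S (abs_time u)) x.
have hlip u v : h u <= h v + `|u - v|.
  rewrite /h; apply: le_trans (rdist_triangle _ (S (abs_time v)) _) _.
  rewrite addrC lerD2l; apply: le_trans (rdist_patrol _ _ _) _.
  exact: ler_dist_dist.
have ch : continuous h.
  move=> u; apply/cvgrPdist_le => /= e e0; near=> v.
  have uv : `|u - v| <= e by near: v; exact: cvgr_dist_le.
  rewrite ler_norml; have := hlip u v; have := hlip v u.
  by rewrite (distrC v); move=> *; apply/andP; split; lra.
have tt : tau <= tau + alpha by rewrite lerDl.
have [c] := EVT_min tt (continuous_subspaceT ch).
rewrite in_itv /= => /andP[c0 c1] hc.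
have [hc0|hc0] := leP (h c) 0.
  exists (abs_time c); split; last exact: rdist_eq0.
  by rewrite /= ger0_norm ?(le_trans tau0)// c0.
(* One third bounds [h] at the approximate hit [t], another the move from [t] to its projection [u]
   on the interval, so [h u] would be below the minimum [h c]. *)
have e0 : 0 < h c / 3 by rewrite divr_gt0.
have [t [/andP[t0 t1] xt]] := H _ e0.
have ht : h t%:num < h c / 3.
  rewrite /h (_ : abs_time t%:num = t)//.
  by apply/val_inj; rewrite /= ger0_norm.
pose u := Num.max tau (Num.min t%:num (tau + alpha)).
have hu : h c <= h u.
  apply: hc; rewrite in_itv /= le_max lexx /= ge_max tt /=.
  by rewrite ge_min lexx orbT.
have := hlip u t%:num; suff : `|u - t%:num| <= h c / 3 by lra.
rewrite ler_norml /u; case: (leP t%:num (tau + alpha)) => ?.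
  by case: (leP tau) => ?; apply/andP; split; lra.
by case: (leP tau) => ?; apply/andP; split; lra.
Unshelve. all: by end_near. Qed.

End RealDist.

(** * The set of intercepted pairs as a countable combination of measurable sets *)

Section Measurability.
Context {R : realType} {Q : network R}.

Local Notation strategy_pairs :=
  (patrol Q * (borel_network Q * borel_time R))%type.

Lemma measurable_position (t : {nonneg R}) :
  measurable_fun [set: patrol Q] (fun S : patrol Q => S t : borel_network Q).
Proof.
move=> _ B mB; rewrite setTI; apply: sub_sigma_algebra.
by exists t, B.
Qed.

Lemma measurable_time_val : measurable_fun [set: borel_time R] time_val.
Proof.
move=> _ B mB; rewrite setTI; exists B => //.
by rewrite setTI.
Qed.

(** Comparing patrol and attacked point with a fixed third point [z] replaces a condition on the
    pair by conditions on single components. The radius is doubled for the patrol, whose distance to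
    [z] is estimated through the attacked point. *)
Let approx (alpha e : R) (i : rat * (arcs Q * rat)) : set strategy_pairs :=
  let z := arc_pt i.2.1 (ratr i.2.2) in
  (fun w : strategy_pairs => w.1 (abs_time (ratr i.1)) : borel_network Q) @^-1`
    [set y | rdist y z < e * 2] `&`
  ((fun w : strategy_pairs => w.2.1) @^-1` [set y | rdist y z < e] `&`
  (fun w : strategy_pairs => time_val w.2.2) @^-1`
    `[`|ratr i.1| - alpha - e, `|ratr i.1| + e]).

Let approx_measurable alpha e i : measurable (approx alpha e i).
Proof.
apply: measurableI; last apply: measurableI.
- rewrite -[X in measurable X]setTI.
  apply: (measurableT_comp (measurable_position _) measurable_fst) => //.
  exact: measurable_rball.
- rewrite -[X in measurable X]setTI.
  apply: (measurableT_comp measurable_fst measurable_snd) => //.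
  exact: measurable_rball.
- rewrite -[X in measurable X]setTI.
  apply: (measurableT_comp measurable_time_val
    (measurableT_comp measurable_snd measurable_snd)) => //.
Qed.

(* A patrol meets [x] during the attack iff at some rational time close to the
   attack interval it is close to a rational point of an arc close to [x]. *)
Lemma intercepts_measurable (alpha : R) : 0 <= alpha -> arcs Q ->
  measurable [set w : strategy_pairs | intercepts alpha w.1 w.2].
Proof.
move=> alpha0 a0.
rewrite (_ : [set w | _] = \bigcap_n \bigcup_i approx alpha n.+1%:R^-1 i).
  apply: bigcapT_measurable => n; exact: countable_bigcupT_measurable.
apply/seteqP; split=> [[S [x tau]] /= [t [/andP[t0 t1] Sx]] n _|[S [x tau]] H].
  set e := n.+1%:R^-1; have e0 : 0 < e :> R by rewrite invr_gt0.
  have /rat_in_itvoo[r] : t%:num < t%:num + e by rewrite ltrDl.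
  rewrite in_itv /= => /andP[r0 r1].
  have [a [s [_ xE]]] := arc_ptP x a0.
  have /rat_in_itvoo[q] : s < s + e by rewrite ltrDl.
  rewrite in_itv /= => /andP[q0 q1].
  have rt : 0 < ratr r :> R by apply: le_lt_trans r0.
  have xz : rdist x (arc_pt a (ratr q)) < e.
    rewrite xE; apply: le_lt_trans (rdist_arc_pt _ _ _) _.
    by rewrite ltr_norml; apply/andP; split; lra.
  exists (r, (a, q)) => //; rewrite /approx /=; split; [|split] => //=.
    apply: le_lt_trans (rdist_triangle _ x _) _.
    rewrite mulr_natr mulr2n ltrD//.
    rewrite -[x]Sx.
    apply: le_lt_trans (rdist_patrol _ _ _) _ => /=.
    rewrite (gtr0_norm rt) ltr_norml; apply/andP; split; lra.
  rewrite in_itv /= (gtr0_norm rt); move: t0 t1 => /= t0 t1.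
  by apply/andP; split; lra.
have tau0 : 0 <= time_val tau by rewrite /time_val.
apply: (patrol_hits tau0 alpha0) => e e0.
  (* The radii [2 * d] and [d], with [d] the inverse of [n.+1], add up to [3 * d], which must be
     below [e]. *)
  have := Num.Theory.truncnS_gt (3 / e); set n := Num.truncn _ => ne.
  have {ne} ne : n.+1%:R^-1 * 3 < e.
    by rewrite mulrC ltr_pdivrMr// mulrC -ltr_pdivrMr.
  have n0 : 0 < n.+1%:R^-1 :> R by rewrite invr_gt0.
  have [[r [a q]] _ [/= Sz [xz]]] := H n I.
  rewrite in_itv /= => /andP[]; move: Sz xz ne n0.
  move: (n.+1%:R^-1) => d Sz xz ne n0 r0 r1.
  exists (abs_time (ratr r)); split => /=.
    by apply/andP; split; lra.
  apply: le_lt_trans (rdist_triangle _ (arc_pt a (ratr q)) _) _.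
  by rewrite (rdist_sym _ x); lra.
Qed.
End Measurability.

(** * Length of the image of a patrol *)

Lemma lebesgue_measure_bnd (R : realType) (x y : R) (b c : bool) : x <= y ->
  lebesgue_measure [set` Interval (BSide b x) (BSide c y)] = (y - x)%:E.
Proof.
move=> xy; rewrite lebesgue_measure_itv /= lte_fin; case: ltP => //= yx.
by rewrite (@le_anti _ _ x y) ?subrr// xy.
Qed.

Section ImageLength.
Context {R : realType} {Q : network R}.

(** Points visited within a time [delta] are at distance at most [delta], too little to reach an end
    of an arc from a point at least [eps] away from both ends. Hence all such points lie on one arc,
    in an interval of length [delta]. *)
Lemma short_piece (S : patrol_fun Q) (a0 : arcs Q) (u delta eps : R) :
  0 <= delta < eps -> exists (p : arcs Q * R), forall a s (t : {nonneg R}),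
    eps <= s <= len a - eps -> u <= t%:num <= u + delta -> S t = arc_pt a s ->
    a = p.1 /\ p.2 <= s <= p.2 + delta.
Proof.
move=> /andP[d0 de].
have close_hits a s (t : {nonneg R}) b s' (t' : {nonneg R}) :
    eps <= s <= len a - eps -> u <= t%:num <= u + delta -> S t = arc_pt a s ->
    eps <= s' <= len b - eps -> u <= t'%:num <= u + delta ->
    S t' = arc_pt b s' ->
    b = a /\ `|s' - s| <= delta.
  move=> /andP[s0 s1] /andP[t0 t1] St /andP[s0' s1'] /andP[t0' t1'] St'.
  have : (dist (arc_pt a s) (arc_pt b s') <= delta%:E)%E.
    rewrite -St -St' distE lee_fin; apply: le_trans (rdist_patrol _ _ _) _.
    by rewrite ler_norml; apply/andP; split; lra.
  move=> /dist_on_arc[||r]; [lra|lra|].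
  have h : 0 < s' < len b by apply/andP; split; lra.
  by move=> + [ds hr] => /(arc_pt_inj h hr)[-> ->].
pose hit (w : arcs Q * R * {nonneg R}) := [/\ eps <= w.1.2 <= len w.1.1 - eps,
   u <= w.2%:num <= u + delta & S w.2 = arc_pt w.1.1 w.1.2].
have [[[[b s0] t0] [/= hs0 ht0 Ht0]]|none] := pselect (exists w, hit w);
  last first.
  by exists (a0, 0) => a s t hs ht St; exfalso; apply: none; exists (a, s, t).
pose K := [set s | exists t, hit (b, s, t)].
have Ks0 : K s0 by exists t0.
have lbK : has_lbound K by exists eps => s [t [/= /andP[]]].
(* Any two coordinates in [K] differ by at most [delta], so all lie within [delta] above the
   infimum. *)
exists (b, inf K) => a s t hs ht St /=.
have [ab _] := close_hits _ _ _ _ _ _ hs0 ht0 Ht0 hs ht St.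
split => //; subst a.
rewrite ge_inf//=; last by exists t.
rewrite -lerBlDr; apply: lb_le_inf; first by exists s0.
move=> s' [t' [/= hs' ht' St']].
have [_] := close_hits _ _ _ _ _ _ hs' ht' St' hs ht St.
by rewrite ler_norml => /andP[]; lra.
Qed.

Lemma subdivision_index (n : nat) (r delta : R) : 0 <= r <= n.+1%:R * delta ->
  exists2 k, (k < n.+1)%N & k%:R * delta <= r <= k%:R * delta + delta.
Proof.
elim: n => [|n IH] /andP[r0 r1].
  by exists 0%N => //; rewrite mul0r add0r r0 -[delta]mul1r.
have [rn|/ltW rn] := leP r (n.+1%:R * delta).
  by have [|k kn hk] := IH; [rewrite r0|exists k => //; exact: leqW].
exists n.+1 => //; rewrite rn /=; apply: le_trans r1 _.
by rewrite -natr1 mulrDl mul1r.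
Qed.

(** The attack interval is cut into [N] windows of duration [delta]. Away from the ends of the arcs
    each window contributes an interval of length [delta], in total [alpha]; the ends contribute
    [2 * eps] per arc, in total at most [e]. *)
Lemma length_image_le (S : patrol_fun Q) (M alpha : R) (X : set (npoint Q)) :
  0 <= alpha -> measurable (X : set (borel_network Q)) ->
  (forall x, X x -> exists t : {nonneg R},
    M <= t%:num <= M + alpha /\ S t = x) ->
  (length_measure (X : set (borel_network Q)) <= alpha%:E)%E.
Proof.
move=> alpha0 mX hitX; rewrite /length_measure.
have [a0|noarc] := pselect (exists a : arcs Q, True); last first.
  by rewrite big1 ?lee_fin// => a; exfalso; apply: noarc; exists a.
case: a0 => a0 _; apply/lee_addgt0Pr => e e0.
pose c : R := 1 + 2 * #|arcs Q|%:R.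
have c0 : 0 < c by rewrite /c; have := ler0n R #|arcs Q|; lra.
pose eps := e / c; have eps0 : 0 < eps by rewrite divr_gt0.
pose N := (Num.truncn (alpha / eps)).+1.
have N0 : 0 < N%:R :> R by rewrite ltr0n.
pose delta := alpha / N%:R.
have hdelta : 0 <= delta < eps.
  rewrite /delta divr_ge0//= ?ltW// ltr_pdivrMr// mulrC -ltr_pdivrMr//.
  exact: Num.Theory.truncnS_gt.
have [p Hp] := choice (fun k : nat =>
  @short_piece S a0 (M + k%:R * delta) delta eps hdelta).
pose J a k : set R :=
  if a == (p k).1 then `[(p k).2, (p k).2 + delta]%classic else set0.
have mJ a k : measurable (J a k) by rewrite /J; case: ifP.
have muJ a k : lebesgue_measure (J a k) = ((a == (p k).1)%:R * delta)%:E.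
  rewrite /J; case: ifP => _; last by rewrite measure0 mul0r.
  rewrite lebesgue_measure_bnd; first by rewrite mul1r addrAC subrr add0r.
  by rewrite lerDl; move/andP: hdelta => [].
have mXa a : measurable [set s : R | X (arc_pt a s) /\ 0 < s < len a].
  rewrite (_ : [set s | _] = (arc_pt a @^-1` X) `&` `]0, len a[); last first.
    by apply/seteqP; split=> s /=; rewrite in_itv.
  apply: measurableI => //; rewrite -[X in measurable X]setTI.
  exact: arc_pt_measurable.
have bound a : (lebesgue_measure
      [set s : R | X (arc_pt a s) /\ (0 < s < len a)%R] <=
    (eps + eps + \sum_(k < N) (a == (p k).1)%:R * delta)%:E)%E.
  pose A : set R := `]0, eps[%classic `|` `](len a - eps), (len a)[%classic.
  pose B := \big[setU/set0]_(k < N) J a k.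
  have mA : measurable A by apply: measurableU.
  have mB : measurable B by apply: bigsetU_measurable => k _.
  apply: (@le_trans _ _ (lebesgue_measure (A `|` B))).
    apply: le_measure; rewrite ?inE; [exact: mXa|exact: measurableU|].
    move=> s [Xs /andP[s0 s1]]; rewrite /A /=.
    have [s2|s2] := ltP s eps; first by left; left; rewrite in_itv /= s0.
    have [s3|s3] := ltP (len a - eps) s.
      by left; right; rewrite in_itv /= s3.
    right; have [t [/andP[t0 t1] St]] := hitX _ Xs.
    have [|k kN /andP[k0 k1]] := @subdivision_index N.-1 (t%:num - M) delta.
      by rewrite /delta mulrC divfK ?gt_eqF//; apply/andP; split; lra.
    have [||pa ps] := Hp k a s t _ _ St; [lra|lra|].
    rewrite /B -bigcup_mkord; exists k => //.
    by rewrite /J pa eqxx /= in_itv.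
  apply: le_trans (measureU2 _ _ _) _ => //; rewrite EFinD; apply: leeD.
    apply: le_trans (measureU2 _ _ _) _ => //; rewrite EFinD.
    by apply: leeD; rewrite [leLHS]lebesgue_measure_bnd ?lee_fin; lra.
  apply: (@le_trans _ _ (\sum_(k < N) lebesgue_measure (J a k))%E).
    apply: (@content_subadditive _ _ _ lebesgue_measure) => // k _.
    exact: mJ.
  rewrite (eq_bigr (fun k : 'I_N => ((a == (p k).1)%:R * delta)%:E)).
    by rewrite sumEFin.
  by move=> k _; rewrite muJ.
apply: (@le_trans _ _ (\sum_(a : arcs Q)
    (eps + eps + \sum_(k < N) (a == (p k).1)%:R * delta)%:E)%E).
  by apply: lee_sum => a _; exact: bound.
(* After the exchange of sums, the window [k] counts [delta] for the single arc [(p k).1]. *)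
rewrite sumEFin lee_fin big_split/= sumr_const exchange_big/=.
rewrite (eq_bigr (fun=> delta)); last first.
  move=> k _; rewrite -mulr_suml (bigD1 (p k).1)//= eqxx big1 ?addr0 ?mul1r//.
  by move=> a /negbTE ->.
rewrite sumr_const card_ord -(mulr_natl delta).
rewrite (_ : N%:R * delta = alpha); last by rewrite /delta mulrC divfK// gt_eqF.
rewrite addrC lerD2l (_ : e = eps * c); last by rewrite divfK// gt_eqF.
by rewrite /c -mulr_natr; nra.
Qed.

End ImageLength.

(** * Cutting a circle open *)

Section CircleMeasure.
Context {R : realType}.
Local Notation mu := (@lebesgue_measure R).

Lemma real_modDz (t L : R) (k : int) : 0 < L ->
  real_mod (t + k%:~R * L) L = real_mod t L.
Proof.
move=> L0; rewrite /real_mod mulrDl mulfK ?gt_eqF//.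
by rewrite Num.Theory.floorDrz ?intr_int// Num.Theory.intrKfloor intrD; ring.
Qed.

(** One cut of the circle splits at most one of two disjoint arcs, leaving at most three intervals;
    a missing one is taken empty, with equal ends. *)
Lemma lebesgue_three_itv (G : set R) (x1 y1 x2 y2 x3 y3 l : R) :
  measurable G -> x1 <= y1 -> y1 <= x2 -> x2 <= y2 -> y2 <= x3 -> x3 <= y3 ->
  `[x1, y1[ `<=` G -> `[x2, y2[ `<=` G -> `[x3, y3[ `<=` G ->
  (y1 - x1) + (y2 - x2) + (y3 - x3) = l -> (l%:E <= mu G)%E.
Proof.
move=> mG h1 h12 h2 h23 h3 G1 G2 G3 <-.
rewrite [leLHS](_ : _ = mu `[x1, y1[%classic + mu `[x2, y2[%classic +
  mu `[x3, y3[%classic)%E; last by rewrite !lebesgue_measure_bnd.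
rewrite -!measureU//.
- apply: le_measure; rewrite ?inE//.
    by apply: measurableU => //; exact: measurableU.
  by move=> s [[/G1|/G2]|/G3].
- exact: measurableU.
- apply/seteqP; split=> // s [[]] /=; rewrite !in_itv /=; lra.
- apply/seteqP; split=> // s [] /=; rewrite !in_itv /=; lra.
Qed.

(* Two disjoint arcs of length [alpha] of a circle of length [L] keep their
   total length when the circle is cut open at 0. *)
Lemma two_arcs_measure (G : set R) (L alpha c1 c2 : R) :
  0 < L -> 0 <= alpha -> measurable G ->
  (forall D (k : int), G D -> G (D + k%:~R * L)) ->
  (forall D, c1 <= D <= c1 + alpha -> G D) ->
  (forall D, c2 <= D <= c2 + alpha -> G D) ->
  c1 + alpha <= c2 -> c2 + alpha <= c1 + L ->
  ((2 * alpha)%:E <= mu (G `&` `[0%R, L]))%E.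
Proof.
move=> L0 a0 mG perG; wlog c10 : c1 c2 / 0 <= c1 < L.
  move=> H G1 G2 c12 c21; pose k := Num.floor (c1 / L).
  have perG' D : G (D + k%:~R * L) -> G D.
    by move=> /(perG _ (- k)); rewrite mulrNz mulNr addrK.
  apply: (H (real_mod c1 L) (c2 - k%:~R * L)); first exact: real_mod_itv.
  - move=> D hD; apply: perG'; apply: G1; move: hD; rewrite /real_mod -/k; lra.
  - by move=> D hD; apply: perG'; apply: G2; lra.
  - by rewrite /real_mod -/k; lra.
  - by rewrite /real_mod -/k; lra.
have /andP[c10' c1L] := c10.
have perG1 D : G (D + L) -> G D.
  by move=> /(perG _ (- 1)); rewrite mulN1r addrK.
move=> G1 G2 c12 c21.
have mGL : measurable (G `&` `[0, L]) by apply: measurableI.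
(* The cut [L] lies after both arcs, inside the second, between them, or inside the first. What
   exceeds [L] is moved back by one period. *)
have [h1|h1] := leP (c2 + alpha) L.
  apply: (@lebesgue_three_itv _ c1 (c1 + alpha) c2 (c2 + alpha) (c2 + alpha)
    (c2 + alpha) _ mGL); try lra;
    move=> D; rewrite /= !in_itv /= => hD; split; try lra.
  - by apply: G1; lra.
  - by apply: G2; lra.
have [h2|h2] := leP c2 L.
  apply: (@lebesgue_three_itv _ 0 (c2 + alpha - L) c1 (c1 + alpha)
    c2 L _ mGL); try lra;
    move=> D; rewrite /= !in_itv /= => hD; split; try lra.
  - by apply: perG1; apply: G2; lra.
  - by apply: G1; lra.
  - by apply: G2; lra.
have [h3|h3] := leP (c1 + alpha) L.
  apply: (@lebesgue_three_itv _ (c2 - L) (c2 - L + alpha) c1 (c1 + alpha)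
    (c1 + alpha) (c1 + alpha) _ mGL); try lra;
    move=> D; rewrite /= !in_itv /= => hD; split; try lra.
  - by apply: perG1; apply: G2; lra.
  - by apply: G1; lra.
apply: (@lebesgue_three_itv _ 0 (c1 + alpha - L) (c2 - L)
  (c2 - L + alpha) c1 L _ mGL); try lra;
  move=> D; rewrite /= !in_itv /= => hD; split; try lra.
- by apply: perG1; apply: G1; lra.
- by apply: perG1; apply: G2; lra.
- by apply: G1; lra.
Qed.

Lemma uniform_probE (a b : R) (ab : a < b) (G : set R) : measurable G ->
  uniform_prob ab G = ((b - a)^-1%:E * mu (G `&` `[a, b]))%E.
Proof.
move=> mG; rewrite /uniform_prob integral_uniform_pdf.
rewrite (eq_integral (fun=> (b - a)^-1%:E)); last first.
  by move=> x; rewrite inE => -[_] /=; rewrite in_itv /= /uniform_pdf => ->.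
by rewrite integral_cst//; exact: measurableI.
Qed.

End CircleMeasure.

(** * Value of the game *)

Lemma mnormalizeE d (T : measurableType d) (R : realType)
    (mu : {measure set T -> \bar R}) (P : probability T R) (m : R) (X : set T) :
  mu setT = m%:E -> m != 0 -> mnormalize mu P X = (mu X * m^-1%:E)%E.
Proof. by move=> mT m0; rewrite /mnormalize mT eqe (negbTE m0). Qed.

Section Value.
Context {R : realType} {Q : network R}.

Lemma length_measureT :
  length_measure [set: borel_network Q] = (\sum_(a : arcs Q) len a)%:E.
Proof.
rewrite /length_measure -sumEFin; apply: eq_bigr => a _.
rewrite (_ : [set s | _] = `]0, len a[%classic); last first.
  by apply/seteqP; split=> s /=; rewrite in_itv //= => -[].
by rewrite lebesgue_measure_bnd ?subr0// ltW ?len_gt0.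
Qed.

Lemma total_lengthE : total_length Q = \sum_(a : arcs Q) len a.
Proof. by rewrite /total_length length_measureT. Qed.

Lemma total_length_gt0 : arcs Q -> 0 < total_length Q.
Proof.
move=> a; rewrite total_lengthE (bigD1 a)//= ltr_pwDl ?len_gt0//.
by apply: sumr_ge0 => b _; rewrite ltW ?len_gt0.
Qed.

Lemma uniform_pointE (X : set (borel_network Q)) : arcs Q ->
  uniform_point Q X = (length_measure X * (total_length Q)^-1%:E)%E.
Proof.
move=> a; apply: mnormalizeE; last by rewrite gt_eqF// total_length_gt0.
by rewrite total_lengthE; exact: length_measureT.
Qed.

Variable alpha : R.
Hypotheses (alpha0 : 0 < alpha) (a0 : arcs Q).

Let V := alpha / total_length Q.

Let V0 : 0 <= V.
Proof. by rewrite divr_ge0 ?ltW ?total_length_gt0. Qed.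

Let mI := @intercepts_measurable R Q alpha (ltW alpha0) a0.

Lemma payoff_uniform_attack_le (P : probability (patrol Q) R) (M : {nonneg R}) :
  (payoff alpha P (uniform_attack Q M) <= V%:E)%E.
Proof.
(* With [V] written as the integral of a constant against [P], it suffices to bound the interception
   probability of each pure patrol. *)
rewrite /payoff /product_measure1 -[leRHS]mule1 -(@probability_setT _ _ _ P).
rewrite -integral_cst//; apply: ge0_le_integral => //.
  exact: measurable_fun_xsection.
move=> S _ /=; have mX := measurable_xsection S mI.
set X := xsection _ S in mX *.
rewrite /uniform_attack /distribution /pushforward /=.
rewrite uniform_pointE// /V EFinM lee_wpmul2r//.
  by rewrite lee_fin invr_ge0 ltW// total_length_gt0.
apply: (@length_image_le _ _ S M%:num alpha); first exact: ltW.
- rewrite -[X in measurable X]setTI; exact: attack_at_measurable.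
- by move=> x; rewrite /X /xsection /= inE.
Qed.

Lemma walk_length_twice (w : seq (dart Q)) :
  (forall a : arcs Q, count (fun e : dart Q => e.1 == a) w = 2%N) ->
  walk_length w = 2 * total_length Q.
Proof.
move=> cnt; rewrite total_lengthE mulr_sumr /walk_length.
rewrite (partition_big (fun e : dart Q => e.1) xpredT)//=.
apply: eq_bigr => a _.
rewrite (eq_bigr (fun=> len a)); last by move=> e /eqP ->.
by rewrite big_const_seq cnt /= addr0 mulr_natl.
Qed.

Lemma payoff_randomized_extension_ge (S : closed_path Q)
    (A : probability (borel_network Q * borel_time R)%type R) :
  (alpha%:E <= girth Q)%E -> double_tour S ->
  (V%:E <= payoff alpha (randomized_extension S) A)%E.
Proof.
move=> ag S2.
have perS : period S = 2 * total_length Q.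
  by have [w [[_ -> _] cnt _]] := S2; rewrite walk_length_twice.
have L0 := period_gt0 S.
rewrite /payoff.
have mJ := mI; set I := [set w | _] in mJ *.
(* Integrating over the attack last reduces the bound to a fixed attack [(x, tau)]. *)
have -> : (randomized_extension S \x A)%E I =
    (randomized_extension S \x^ A)%E I.
  by apply: product_measure_unique => //= ? ? ? ?; rewrite product_measure2E.
rewrite /product_measure2 -[leLHS]mule1 -(@probability_setT _ _ _ A).
rewrite -integral_cst//; apply: ge0_le_integral => //.
  exact: measurable_fun_ysection.
move=> [x tau] _ /=; have mX := measurable_ysection (x, tau) mJ.
set X := ysection _ _ in mX *.
rewrite /randomized_extension /distribution /pushforward /=.
set G := _ @^-1` X.
have mG : measurable G.
  by rewrite /G -[X in measurable X]setTI; exact: shifted_patrol_measurable.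
have tau0 : 0 <= time_val tau by rewrite /time_val.
have GE D : G D <-> exists t : {nonneg R},
    time_val tau <= t%:num <= time_val tau + alpha /\
    rotate_path S D t%:num = x.
  by rewrite /G /X /ysection /= inE.
have [a [s [hs xE]]] := arc_ptP x a0.
have [t1 [t2 [t12 t21 St1 St2]]] := two_visits ag S2 hs.
(* The patrol shifted by [D] is at [x] at time [t - D], which falls in the attack interval when [D]
   is between [t - tau - alpha] and [t - tau]. *)
have hit t c D : S (real_mod t (period S)) = x ->
    c = t - time_val tau - alpha ->
    c <= D <= c + alpha -> G D.
  move=> St -> hD; apply/GE.
  have tD : 0 <= t - D by lra.
  exists (NngNum tD) => /=; split; first by lra.
  by rewrite /rotate_path subrK.
rewrite uniform_probE// subr0.
have : ((2 * alpha)%:E <= lebesgue_measure (G `&` `[0%R, period S]))%E.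
  apply: (two_arcs_measure (c1 := t1 - time_val tau - alpha)
    (c2 := t2 - time_val tau - alpha)) => //.
  - exact: ltW.
  - move=> D k /GE[t [ht Dt]]; apply/GE; exists t; split => //.
    by rewrite -Dt /rotate_path addrA real_modDz.
  - by move=> D; apply: hit => //; rewrite St1.
  - by move=> D; apply: hit => //; rewrite St2.
  - lra.
  - lra.
move=> h; apply: le_trans (lee_wpmul2l _ h); last first.
  by rewrite lee_fin invr_ge0 ltW.
by rewrite -EFinM lee_fin perS /V invfM mulrACA mulVf// mul1r mulrC.
Qed.

End Value.

(** * The saddle point formed by the two strategies *)

Theorem theorem4 (R : realType) (Q : network R) (alpha : R)
    (S2 : closed_path Q)
    (alpha_gt0 : 0 < alpha)
    (alpha_lt : (alpha%:E < covering_length Q)%E)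
    (no_leaf_arc : forall a : arcs Q, ~~ leaf_arc a)
    (alpha_girth : (alpha%:E <= girth Q)%E)
    (S2_tour : double_tour S2) :
  [/\ game_value Q alpha (alpha / total_length Q)%:E,
      forall M : {nonneg R}, optimal_attack alpha (uniform_attack Q M)
    & optimal_patrol alpha (randomized_extension S2)].
Proof.
(* The tour has positive period, so its walk contains a dart. *)
have [a0] : inhabited (arcs Q).
  have [[|e w] [[_ Lw _] _ _]] := S2_tour; last by constructor; exact: e.1.
  by have := period_gt0 S2; rewrite Lw /walk_length big_nil ltxx.
have attack := payoff_uniform_attack_le alpha_gt0 a0.
have defend A :=
  payoff_randomized_extension_ge alpha_gt0 a0 A alpha_girth S2_tour.
have value : game_value Q alpha (alpha / total_length Q)%:E.
  (* Maximin and minimax are both bounded above by fixing the uniform attack at time 0, and below by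
     fixing the randomized extension. *)
  split; apply/eqP; rewrite eq_le; apply/andP; split.
  - apply: ge_ereal_sup => _ [P _ <-]; apply: ge_ereal_inf.
    exists (payoff alpha P (uniform_attack Q (NngNum (lexx 0))));
      last exact: attack.
    by exists (uniform_attack Q (NngNum (lexx 0))).
  - apply: le_ereal_sup_tmp.
    exists (ereal_inf [set payoff alpha (randomized_extension S2) A |
      A in [set: probability (borel_network Q * borel_time R)%type R]]).
      by exists (randomized_extension S2).
    by apply: le_ereal_inf_tmp => _ [A _ <-]; exact: defend.
  - apply: ge_ereal_inf.
    exists (ereal_sup [set payoff alpha P (uniform_attack Q (NngNum (lexx 0))) |
      P in [set: probability (patrol Q) R]]).
      by exists (uniform_attack Q (NngNum (lexx 0))).
    by apply: ge_ereal_sup => _ [P _ <-]; exact: attack.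
  - apply: le_ereal_inf_tmp => _ [A _ <-]; apply: le_ereal_sup_tmp.
    exists (payoff alpha (randomized_extension S2) A); last exact: defend.
    by exists (randomized_extension S2).
by split => // [M|]; exists (alpha / total_length Q)%:E => // P.
Qed.
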